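(* Let $h\in(0,1]$. Let $f:h\mathbb{Z}^2\times\mathbb{R}\to\mathbb{R}$ and let $u:h\mathbb{Z}^2\to\mathbb{R}$ be a solution of $$\mathcal{L}u_i=f(i,u_i)\qquad\text{for all } i\in h\mathbb{Z}^2 .$$ Assume that there exist a function $L_f^+:h\mathbb{Z}^2\times\mathbb{R}\to\mathbb{R}$ and a finite positive constant $\kappa_0^+$ such that $$\sum_{j=1}^2\frac{\big|f(i+he_j,u_{i+he_j})-f(i,u_i)-L_f^+(i,u_i)(u_{i+he_j}-u_i)\big|}{h}\le\kappa_0^+\,h\qquad\text{for all } i\in h\mathbb{Z}^2 .$$ Assume also that $$\sum_{j=1}^2|u_{i+he_j}-u_i|^2>0\qquad\text{for all } i\in h\mathbb{Z}^2,$$ that $$\kappa_1^+:=\sup_{i\in h\mathbb{Z}^2,\,1\le j\le2}|\mathcal{D}_j^+u_i|<+\infty,$$ that $\kappa_2^+<+\infty$, and that there exists $\vartheta_\infty^+\in(-\pi,\pi]$ for which $\kappa_3^+,\kappa_4^+,\kappa_5^+,\kappa_6^+,\kappa_7^+$ are all finite (the quantities $\kappa_2^+,\dots,\kappa_7^+$ being those defined in the context in terms of $u$, $h$, $\kappa_0^+$ and $\vartheta_\infty^+$). Then $$\sum_{i\in h\mathbb{Z}^2}\sum_{j=1}^2(\rho_i^+)^2\Big(|\mathcal{D}_j^+\vartheta_i^+|^2+|\mathcal{D}_j^-\vartheta_i^+|^2\Big)\le C\,h,$$ where $$C:=4\left(\kappa_2^++2e^{2\pi}\kappa_3^++2e^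{2\pi}\kappa_4^++2\kappa_5^++\kappa_6^++\kappa_7^+\right).$$
   Context: Notation. $e_1=(1,0)$, $e_2=(0,1)$, and $\mathcal{I}=\sqrt{-1}$. For a function $g:h\mathbb{Z}^2\to\mathbb{R}$, $i\in h\mathbb{Z}^2$ and $j\in\{1,2\}$: $$\mathcal{D}_j^+g_i:=\frac{g_{i+he_j}-g_i}{h},\quad \mathcal{D}_j^-g_i:=\frac{g_i-g_{i-he_j}}{h},\quad \mathcal{L}_jg_i:=\frac{g_{i+he_j}+g_{i-he_j}-2g_i}{h^2},\quad \mathcal{L}:=\mathcal{L}_1+\mathcal{L}_2 .$$ $\mathcal{L}_j^2$ denotes $\mathcal{L}_j$ applied twice, $\mathcal{D}_j^\pm(\mathcal{D}_j^\pm g)_k$ is $\mathcal{D}_j^\pm$ applied to the function $i\mapsto\mathcal{D}_j^\pm g_i$ and evaluated at $k$, and $\mathcal{D}_j^\pm(\rho_i^+)^2$ is $\mathcal{D}_j^\pm$ of the function $i\mapsto(\rho_i^+)^2$ evaluated at $i$. Set $U_i^+:=\mathcal{D}_1^+u_i+\mathcal{I}\,\mathcal{D}_2^+u_i\in\mathbb{C}$ and $\rho_i^+:=|U_i^+|$. Under the assumption $\sum_{j=1}^2|u_{i+he_j}-u_i|^2>0$ one has $\rho_i^+>0$, and $\vartheta_i^+\in(-\pi,\pi]$ is the (unique) angle such that $U_i^+=\rho_i^+e^{\mathcal{I}\vartheta_i^+}$. All sums below are over $i\in h\mathbb{Z}^2$ and $1\le j\le2$ (or over $i\in h\mathbb{Z}^2$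 only for $\kappa_5^+$): $$\kappa_2^+:=\sum_{i,j}(\rho_i^+)^2\Big(|\mathcal{D}_j^+\vartheta_i^+|\,|\mathcal{D}_j^+(\mathcal{D}_j^+\vartheta^+)_{i-he_j}|+|\mathcal{D}_j^-\vartheta_i^+|\,|\mathcal{D}_j^-(\mathcal{D}_j^-\vartheta^+)_{i+he_j}|\Big),$$ $$\kappa_3^+:=\sum_{i,j}(\rho_i^+)^2\Big(|\mathcal{D}_j^+\vartheta_i^+|^3+|\mathcal{D}_j^-\vartheta_i^+|^3\Big)|\vartheta_i^+-\vartheta_\infty^+|,$$ $$\kappa_4^+:=\sum_{i,j}\rho_i^+\Big(|\mathcal{D}_j^+\rho_i^+|\,|\mathcal{D}_j^+\vartheta_i^+|^2+|\mathcal{D}_j^-\rho_i^+|\,|\mathcal{D}_j^-\vartheta_i^+|^2\Big)|\vartheta_i^+-\vartheta_\infty^+|,$$ $$\kappa_5^+:=\kappa_0^+\sum_{i}\rho_i^+\,|\vartheta_i^+-\vartheta_\infty^+|,$$ $$\kappa_6^+:=\sum_{i,j}\Big(|\mathcal{D}_j^+(\rho_i^+)^2|\,|\mathcal{D}_j^+(\mathcal{D}_j^+\vartheta^+)_i|+|\mathcal{D}_j^-(\rho_i^+)^2|\,|\mathcal{D}_j^-(\mathcal{D}_j^-\vartheta^+)_i|+h(\rho_i^+)^2|\mathcal{L}_j^2\vartheta_i^+|\Big)|\vartheta_i^+-\vartheta_\infty^+|,$$ $$\kappa_7^+:=\sum_{i,j}\Big(|\mathcal{D}_j^+\rho_i^+|^2|\mathcal{D}_j^+\vartheta_i^+|+|\mathcal{D}_j^-\rho_i^+|^2|\mathcal{D}_j^-\vartheta_i^+|\Big)|\vartheta_i^+-\vartheta_\infty^+|.$$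 *)

(* Defs.v *)
From HB Require Import structures.
From mathcomp Require Import all_boot all_order all_algebra.
From mathcomp Require Import all_classical all_reals all_analysis.
From mathcomp Require Import complex.

Set Implicit Arguments.
Unset Strict Implicit.
Unset Printing Implicit Defensive.

Import Order.TTheory GRing.Theory Num.Theory.
Import numFieldNormedType.Exports.

Local Open Scope classical_set_scope.
Local Open Scope ring_scope.

(* A function on the lattice is represented by a total function on
   'rV[R]_2, of which only the values at points of [hZ2 h] are ever used.
   The coordinate directions 1, 2 are the elements 0, 1 of 'I_2. *)
Definition hZ2 (R : realType) (h : R) : set 'rV[R]_2 :=
  [set i | exists k : 'rV[int]_2, i = h *: map_mx intr k].

Definition basis_vec (R : realType) (j : 'I_2) : 'rV[R]_2 := delta_mx 0 j.

Definition Dplus (R : realType) (h : R) (j : 'I_2) (g : 'rV[R]_2 -> R)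
    (i : 'rV[R]_2) : R :=
  (g (i + h *: basis_vec R j) - g i) / h.

Definition Dminus (R : realType) (h : R) (j : 'I_2) (g : 'rV[R]_2 -> R)
    (i : 'rV[R]_2) : R :=
  (g i - g (i - h *: basis_vec R j)) / h.

Definition Lap1 (R : realType) (h : R) (j : 'I_2) (g : 'rV[R]_2 -> R)
    (i : 'rV[R]_2) : R :=
  (g (i + h *: basis_vec R j) + g (i - h *: basis_vec R j) - 2 * g i) / h ^+ 2.

Definition Lap (R : realType) (h : R) (g : 'rV[R]_2 -> R) (i : 'rV[R]_2) : R :=
  Lap1 h 0 g i + Lap1 h 1 g i.

Definition Uplus (R : realType) (h : R) (u : 'rV[R]_2 -> R) (i : 'rV[R]_2) :
    R[i] :=
  (Dplus h 0 u i +i* Dplus h 1 u i)%C.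

Definition rhoplus (R : realType) (h : R) (u : 'rV[R]_2 -> R)
    (i : 'rV[R]_2) : R :=
  Normc.normc (Uplus h u i).

(* exp (sqrt (-1) * t) *)
Definition expi (R : realType) (t : R) : R[i] := (cos t +i* sin t)%C.

(* For z != 0 the set below is a singleton, so the default value 0 plays no
   role; at z = 0 the value is unspecified. *)
Definition principal_arg (R : realType) (z : R[i]) : R :=
  xget 0 [set t | - pi < t <= pi /\ z = ((Normc.normc z)%:C)%C * expi t].

Definition thetaplus (R : realType) (h : R) (u : 'rV[R]_2 -> R)
    (i : 'rV[R]_2) : R :=
  principal_arg (Uplus h u i).

(* The sums over the lattice have nonnegative terms and are taken in \bar R,
   with value +oo when they diverge. *)
Definition kappa1 (R : realType) (h : R) (u : 'rV[R]_2 -> R) : \bar R :=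
  ereal_sup [set (`|Dplus h j u i|)%:E | i in hZ2 h & j in [set: 'I_2]].

Definition kappa2 (R : realType) (h : R) (u : 'rV[R]_2 -> R) : \bar R :=
  let r := rhoplus h u in
  let t := thetaplus h u in
  \esum_(i in hZ2 h) (\sum_(j < 2)
    r i ^+ 2 *
    (`|Dplus h j t i| * `|Dplus h j (Dplus h j t) (i - h *: basis_vec R j)| +
     `|Dminus h j t i| * `|Dminus h j (Dminus h j t) (i + h *: basis_vec R j)|))%:E.

Definition kappa3 (R : realType) (h : R) (u : 'rV[R]_2 -> R) (tinf : R) :
    \bar R :=
  let r := rhoplus h u in
  let t := thetaplus h u in
  \esum_(i in hZ2 h) (\sum_(j < 2)
    r i ^+ 2 * (`|Dplus h j t i| ^+ 3 + `|Dminus h j t i| ^+ 3) *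
    `|t i - tinf|)%:E.

Definition kappa4 (R : realType) (h : R) (u : 'rV[R]_2 -> R) (tinf : R) :
    \bar R :=
  let r := rhoplus h u in
  let t := thetaplus h u in
  \esum_(i in hZ2 h) (\sum_(j < 2)
    r i * (`|Dplus h j r i| * `|Dplus h j t i| ^+ 2 +
           `|Dminus h j r i| * `|Dminus h j t i| ^+ 2) *
    `|t i - tinf|)%:E.

Definition kappa5 (R : realType) (h : R) (u : 'rV[R]_2 -> R)
    (kappa0 tinf : R) : \bar R :=
  let r := rhoplus h u in
  let t := thetaplus h u in
  (kappa0%:E * \esum_(i in hZ2 h) (r i * `|t i - tinf|)%:E)%E.

Definition kappa6 (R : realType) (h : R) (u : 'rV[R]_2 -> R) (tinf : R) :
    \bar R :=
  let r := rhoplus h u in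
  let t := thetaplus h u in
  let r2 := fun k => r k ^+ 2 in
  \esum_(i in hZ2 h) (\sum_(j < 2)
    (`|Dplus h j r2 i| * `|Dplus h j (Dplus h j t) i| +
     `|Dminus h j r2 i| * `|Dminus h j (Dminus h j t) i| +
     h * r i ^+ 2 * `|Lap1 h j (Lap1 h j t) i|) *
    `|t i - tinf|)%:E.

Definition kappa7 (R : realType) (h : R) (u : 'rV[R]_2 -> R) (tinf : R) :
    \bar R :=
  let r := rhoplus h u in
  let t := thetaplus h u in
  \esum_(i in hZ2 h) (\sum_(j < 2)
    (`|Dplus h j r i| ^+ 2 * `|Dplus h j t i| +
     `|Dminus h j r i| ^+ 2 * `|Dminus h j t i|) *
    `|t i - tinf|)%:E.

(* Main.v *)
Require Import Defs.
From HB Require Import structures.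
From mathcomp Require Import all_boot all_order all_algebra.
From mathcomp Require Import all_classical all_reals all_analysis.
From mathcomp Require Import complex.
From mathcomp Require Import ring lra.

Set Implicit Arguments.
Unset Strict Implicit.
Unset Printing Implicit Defensive.

Import Order.TTheory GRing.Theory Num.Theory.
Import numFieldNormedType.Exports.

Local Open Scope classical_set_scope.
Local Open Scope ring_scope.

(** Write [r], [t] for [rhoplus h u], [thetaplus h u], and [phi = t - tinf].
    The pair [p], [q] of forward differences of [u] is [r cos t], [r sin t],
    and differencing the equation shows that both solve the same linear
    equation [Lap g = Lf * g], up to an error controlled by [kappa0 h].  The
    potential [Lf] cancels in the Wronskian [p Lap q - q Lap p], which is
    therefore at most [kappa0 h r] in absolute value ([wronskian_le]).

    In polar form the Wronskian is the discrete divergence of the edge flux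
    [r i * r (i + e j) * sin (t (i + e j) - t i) / h].  This is close to the
    flux of the linear elliptic operator [div (r^2 grad t)], where the edge
    carries the mean of [r^2] at its two ends times [Dplus h j t i]:
    with [s], [d] for [r (i + e j)] and the increment of [t],
      [(r^2 + s^2) / 2 * d - r * s * sin d
         = (s - r)^2 / 2 * d + r * s * (d - sin d)],
    and [|d - sin d|] is at most both [d^2] and [|d|^3].  Hence the divergence
    times [phi] is bounded by [h] times the summands of [kappa7], [kappa4],
    [kappa3] and [kappa5] ([divergence_le]).

    Summation by parts turns the sum of [phi * div (r^2 grad t)] into minus
    one half of the energy to be estimated: the weight [r^2] sits at one end of
    each edge in the energy and is averaged over both ends in the flux
    ([weighted_energy_le]).  No boundary term at infinity appears because,
    for fixed [h], the products of flux and [phi] are absolutely summable: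
    [r] and [t] are bounded, so they are dominated by the summands of
    [kappa5] and [kappa7].  The constants that come out are smaller than the
    ones of the theorem. *)

(** * Sine, cosine and polar coordinates *)

Section Sine.
Variable R : realType.
Implicit Types x d : R.

(** The mean value theorem at 0, in a form whose factor [cos c] can be compared
    with 1. *)
Lemma sin_mvt x : exists2 c, `|c| <= `|x| & sin x = cos c * x.
Proof.
wlog x0 : x / 0 <= x.
  move=> H; have [/H//|/ltW x0] := leP 0 x.
  have [|c cx sE] := H (- x); first by rewrite oppr_ge0.
  exists c; first by rewrite -(normrN x).
  by move: sE; rewrite sinN mulrN => /oppr_inj.
have [|c] := @MVT_segment R sin cos 0 x x0 (fun y _ => is_derive_sin y).
  by apply: continuous_subspaceT => y; exact: continuous_sin.
rewrite in_itv /= => /andP[c0 cx]; rewrite sin0 !subr0 => ->.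
by exists c => //; rewrite !ger0_norm.
Qed.

Lemma normr_sin_le x : `|sin x| <= `|x|.
Proof.
by have [c _ ->] := sin_mvt x; rewrite normrM ler_piMl// cos_max.
Qed.

Lemma one_sub_cos c : 1 - cos c = 2 * sin (c / 2) ^+ 2 :> R.
Proof.
have -> : cos c = cos (c / 2 + c / 2) by rewrite -splitr.
rewrite cosD -[X in X - _](cos2Dsin2 (c / 2)); ring.
Qed.

(** Of the two bounds on [d - sin d], the cubic one below yields the summands
    of [kappa3]; this quadratic one yields those of [kappa4], where a difference
    of [r] already supplies the missing power of [h]. *)
Lemma sub_sin_le2 d : `|d - sin d| <= `|d| ^+ 2.
Proof.
have [c cd sE] := sin_mvt d.
have -> : d - sin d = d * (1 - cos c) by rewrite sE; ring.
rewrite normrM expr2 ler_wpM2l// one_sub_cos.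
have s1 := @sin_max R (c / 2); have s2 := normr_sin_le (c / 2).
rewrite normrM normr_nat normrX.
have -> : `|d| = 2 * (`|d| / 2) :> R by rewrite mulrC divfK.
rewrite ler_wpM2l// expr2; apply: le_trans (ler_piMl _ s1) _ => //.
by apply: (le_trans s2); rewrite normrM normfV normr_nat ler_wpM2r.
Qed.

Lemma sub_sin_le3 d : `|d - sin d| <= `|d| ^+ 3.
Proof.
have [c cd sE] := sin_mvt d.
have -> : d - sin d = d * (1 - cos c) by rewrite sE; ring.
rewrite normrM exprS ler_wpM2l// one_sub_cos.
have s2 := normr_sin_le (c / 2).
rewrite normrM normr_nat normrX.
have : `|sin (c / 2)| <= `|d| / 2.
  by apply: (le_trans s2); rewrite normrM normfV normr_nat ler_wpM2r.
have := normr_ge0 (sin (c / 2)).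
by move: (normr_ge0 d) => *; nra.
Qed.

End Sine.

Section Polar.
Variable R : realType.
Implicit Types (x y r : R).

Lemma polar_exists x y :
  exists2 t : R, - pi < t <= pi &
    let r := Num.sqrt (x ^+ 2 + y ^+ 2) in x = r * cos t /\ y = r * sin t.
Proof.
have s0 : 0 <= x ^+ 2 + y ^+ 2 by rewrite addr_ge0 ?sqr_ge0.
set r := Num.sqrt _; have r2 : r ^+ 2 = x ^+ 2 + y ^+ 2 by rewrite sqr_sqrtr.
have [r0|r0] := eqVneq r 0.
  (* At the origin every angle works. *)
  exists 0; first by rewrite oppr_lt0 pi_gt0 pi_ge0.
  move: r2; rewrite r0 expr0n /= => /esym/eqP; rewrite paddr_eq0 ?sqr_ge0//.
  by rewrite !sqrf_eq0 => /andP[/eqP-> /eqP->]; rewrite !mul0r.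
have rp : 0 < r by rewrite lt_def r0 sqrtr_ge0.
have xr : -1 <= x / r <= 1.
  by rewrite ler_pdivlMr// ler_pdivrMr//; apply/andP; split; nra.
have sE : r * Num.sqrt (1 - (x / r) ^+ 2) = `|y|.
  rewrite -sqrtr_sqr -{1}(ger0_norm (ltW rp)) -sqrtr_sqr -sqrtrM ?sqr_ge0//.
  congr Num.sqrt; transitivity (r ^+ 2 - x ^+ 2); last by rewrite r2; ring.
  by field.
have xE : x = r * cos (acos (x / r)).
  by rewrite acosK ?in_itv//= mulrC divfK.
have [y0|y0] := leP 0 y.
  exists (acos (x / r)).
    rewrite acos_lepi// andbT (lt_le_trans _ (acos_ge0 xr))//.
    by rewrite oppr_lt0 pi_gt0.
  by split=> //; rewrite sin_acos// sE ger0_norm.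
(* In the lower half plane [acos] differs from [pi], so its opposite stays in
   the half-open interval. *)
exists (- acos (x / r)).
  rewrite ltrN2 acos_ltpi; last first.
    case/andP: xr => xr1 ->; rewrite andbT lt_def xr1 andbT.
    apply/eqP => xE1; have : x = - r by rewrite -(divfK r0 x) xE1 mulN1r.
    by move=> xN; move: r2 y0; rewrite xN => *; nra.
  by apply: le_trans (pi_ge0 R); rewrite oppr_le0 acos_ge0.
by split; [rewrite cosN|rewrite sinN mulrN sin_acos// sE ltr0_norm// opprK].
Qed.

Lemma principal_argP (z : R[i]) : - pi < principal_arg z <= pi /\
  z = ((Normc.normc z)%:C)%C * expi (principal_arg z).
Proof.
rewrite /principal_arg; case: xgetP => [_ _ []//|].
case: z => x y /=; have [t tpi [xE yE]] := polar_exists x y.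
move=> /(_ t) []; split=> //=.
by rewrite /expi [RHS]/GRing.mul /= !mul0r subr0 addr0 -xE -yE.
Qed.

End Polar.

(** * The linearised equation and its Wronskian *)

Section Equation.
Variables (R : realType) (h : R).
Implicit Types (g p q u : 'rV[R]_2 -> R) (i : 'rV[R]_2) (j : 'I_2).

Lemma Uplus_polar u i :
  Dplus h 0 u i = rhoplus h u i * cos (thetaplus h u i) /\
  Dplus h 1 u i = rhoplus h u i * sin (thetaplus h u i).
Proof.
have [_] := principal_argP (Uplus h u i).
rewrite -/(thetaplus h u i) -/(rhoplus h u i) [RHS]/GRing.mul /= !mul0r.
by rewrite subr0 addr0 => -[-> ->].
Qed.

Lemma normr_thetaplus_le u i : `|thetaplus h u i| <= pi.
Proof.
have [/andP[lo hi] _] := principal_argP (Uplus h u i).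
by rewrite ler_norml hi ltW.
Qed.

Lemma rhoplus_ge0 u i : 0 <= rhoplus h u i.
Proof. by rewrite /rhoplus /= sqrtr_ge0. Qed.

Lemma rhoplus_le u i :
  rhoplus h u i <= `|Dplus h 0 u i| + `|Dplus h 1 u i|.
Proof.
rewrite -(ger0_norm (addr_ge0 (normr_ge0 _) (normr_ge0 _))) -sqrtr_sqr.
rewrite ler_wsqrtr// sqrrD !real_normK ?num_real// -addrA lerD2l lerDr.
by rewrite mulrn_wge0// mulr_ge0.
Qed.

Lemma sum2E (V : zmodType) (F : 'I_2 -> V) : \sum_(j < 2) F j = F 0 + F 1.
Proof.
rewrite !big_ord_recl big_ord0 addr0; congr (_ + F _); exact/val_inj.
Qed.

Lemma hZ2D i j : hZ2 h i -> hZ2 h (i + h *: basis_vec R j).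
Proof.
case=> k ->; exists (k + delta_mx 0 j).
by rewrite map_mxD map_delta_mx scalerDr.
Qed.

Lemma hZ2B i j : hZ2 h i -> hZ2 h (i - h *: basis_vec R j).
Proof.
case=> k ->; exists (k - delta_mx 0 j).
by rewrite map_mxB map_delta_mx scalerBr.
Qed.

Lemma Lap_Dplus j u i : Lap h (Dplus h j u) i =
  (Lap h u (i + h *: basis_vec R j) - Lap h u i) / h.
Proof.
have C k : i + h *: basis_vec R k + h *: basis_vec R j =
  i + h *: basis_vec R j + h *: basis_vec R k by rewrite addrAC.
have C' k : i - h *: basis_vec R k + h *: basis_vec R j =
  i + h *: basis_vec R j - h *: basis_vec R k by rewrite addrAC.
by rewrite /Lap /Lap1 /Dplus !C !C'; ring.
Qed.

(** The two differences of [u] satisfy one equation with the same potential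
    [Lf i (u i)], which drops out of the antisymmetric combination. *)
Lemma wronskian_le (f Lf : 'rV[R]_2 -> R -> R) u kappa0 i : 0 < h ->
  (forall i, hZ2 h i -> Lap h u i = f i (u i)) ->
  (forall i, hZ2 h i -> \sum_(j < 2)
      `|f (i + h *: basis_vec R j) (u (i + h *: basis_vec R j)) - f i (u i)
        - Lf i (u i) * (u (i + h *: basis_vec R j) - u i)| / h
    <= kappa0 * h) ->
  hZ2 h i ->
  `|Dplus h 0 u i * Lap h (Dplus h 1 u) i -
    Dplus h 1 u i * Lap h (Dplus h 0 u) i| <= rhoplus h u i * (kappa0 * h).
Proof.
move=> h0 u_sol f_lin hi.
pose err j := (f (i + h *: basis_vec R j) (u (i + h *: basis_vec R j))
  - f i (u i) - Lf i (u i) * (u (i + h *: basis_vec R j) - u i)) / h.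
have LapE j : Lap h (Dplus h j u) i = Lf i (u i) * Dplus h j u i + err j.
  by rewrite Lap_Dplus !u_sol//; [rewrite /err /Dplus; ring|exact: hZ2D].
have [p_le q_le] : `|Dplus h 0 u i| <= rhoplus h u i /\
    `|Dplus h 1 u i| <= rhoplus h u i.
  have [-> ->] := Uplus_polar u i.
  by rewrite !normrM !(ger0_norm (rhoplus_ge0 _ _));
    split; rewrite ler_piMr ?rhoplus_ge0 ?cos_max ?sin_max.
have -> : Dplus h 0 u i * Lap h (Dplus h 1 u) i -
    Dplus h 1 u i * Lap h (Dplus h 0 u) i =
    Dplus h 0 u i * err 1 - Dplus h 1 u i * err 0.
  by rewrite !LapE; ring.
apply: (@le_trans _ _ (rhoplus h u i * (`|err 0| + `|err 1|))).
  apply: le_trans (ler_normB _ _) _; rewrite (normrM _ (err 1)) (normrM _ (err 0)).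
  by rewrite [leRHS]mulrDr [X in _ <= X]addrC; apply: lerD; apply: ler_wpM2r.
apply: ler_wpM2l; first exact: rhoplus_ge0.
apply: le_trans (f_lin _ hi); rewrite sum2E.
by rewrite /err !normrM !normfV (gtr0_norm h0).
Qed.

(** With [s = r + h a] and [d = h b] the difference of fluxes is
    [(s - r)^2 / 2 * d + r * s * (d - sin d)].  Splitting [r * s] as
    [r^2 + r * (s - r)] lets the cubic bound on [d - sin d] act on the first
    part and the quadratic one on the second, so that each term gains exactly
    one factor [h]. *)
Lemma flux_sub_sin_le (r a b : R) : 0 < h -> 0 <= r ->
  `|(r ^+ 2 + (r + h * a) ^+ 2) / 2 * b / h
    - r * (r + h * a) * sin (h * b) / h ^+ 2| <=
  h * (`|a| ^+ 2 * `|b| + r ^+ 2 * `|b| ^+ 3 + r * (`|a| * `|b| ^+ 2)).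
Proof.
move=> h0 r0; have hn0 : h != 0 by rewrite gt_eqF.
pose e := (h * b - sin (h * b)) / h ^+ 2.
have -> : (r ^+ 2 + (r + h * a) ^+ 2) / 2 * b / h
    - r * (r + h * a) * sin (h * b) / h ^+ 2 =
    h * a ^+ 2 * b / 2 + r ^+ 2 * e + r * (h * a) * e.
  by rewrite /e; field.
have hi0 : 0 <= (h ^+ 2)^-1 by rewrite invr_ge0 exprn_ge0// ltW.
have e2 : `|e| <= `|b| ^+ 2.
  rewrite /e normrM (ger0_norm hi0) ler_pdivrMr ?exprn_gt0//.
  apply: le_trans (sub_sin_le2 _) _.
  by rewrite normrM (gtr0_norm h0) exprMn mulrC.
have e3 : `|e| <= h * `|b| ^+ 3.
  rewrite /e normrM (ger0_norm hi0) ler_pdivrMr ?exprn_gt0//.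
  apply: le_trans (sub_sin_le3 _) _.
  by rewrite normrM (gtr0_norm h0) exprMn; lra.
rewrite 2!mulrDr; apply: le_trans (ler_normD _ _) _; apply: lerD.
  apply: le_trans (ler_normD _ _) _; apply: lerD.
    rewrite normrM normfV normr_nat ler_pdivrMr// normrM normrM normrX.
    rewrite (gtr0_norm h0) -mulrA ler_peMr// ?ler1n//.
    by rewrite !mulr_ge0// ltW.
  rewrite normrM normrX (ger0_norm r0) mulrCA ler_wpM2l// ?exprn_ge0//.
rewrite (normrM _ e) (normrM r) (normrM h) (ger0_norm r0) (gtr0_norm h0).
rewrite [leRHS](_ : _ = r * (h * `|a|) * `|b| ^+ 2); last by ring.
by rewrite ler_wpM2l// !mulr_ge0// ltW.
Qed.

End Equation.

(** * Summation by parts on the lattice *)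

Section Esum.
Variables (R : realType) (T : choiceType) (D : set T).
Implicit Types a b : T -> R.

Lemma esum_EFinD a b : (forall i, D i -> 0 <= a i) ->
  (forall i, D i -> 0 <= b i) ->
  (\esum_(i in D) (a i + b i)%:E =
   \esum_(i in D) (a i)%:E + \esum_(i in D) (b i)%:E)%E.
Proof.
by move=> a0 b0; rewrite -esumD.
Qed.

Lemma le_esum_EFin a b : (forall i, D i -> a i <= b i) ->
  (\esum_(i in D) (a i)%:E <= \esum_(i in D) (b i)%:E)%E.
Proof. by move=> ab; apply: le_esum => i Di; rewrite lee_fin ab. Qed.

Lemma esum_EFinZ_le (c : R) a : 0 <= c -> (forall i, 0 <= a i) ->
  (\esum_(i in D) (c * a i)%:E <= c%:E * \esum_(i in D) (a i)%:E)%E.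
Proof.
move=> c0 a0; apply: ge_ereal_sup => _ [X [finX XD]] <-.
rewrite (eq_fsbigr (fun i => c%:E * (a i)%:E)%E)// -ge0_mule_fsumr//.
rewrite lee_wpmul2l// ?lee_fin//.
by apply: ereal_sup_ubound; exists X.
Qed.

End Esum.

Section Lattice.
Variables (R : realType) (h : R).
Implicit Types (g : 'rV[R]_2 -> \bar R) (i : 'rV[R]_2) (j : 'I_2).
Local Notation e j := (h *: basis_vec R j).

Lemma esum_hZ2_shift j g :
  (\esum_(i in hZ2 h) g (i - e j)%R = \esum_(i in hZ2 h) g i)%E.
Proof.
apply/esym/reindex_esum; split=> /=.
- by move=> i; exact: hZ2B.
- by move=> x y _ _ /addIr.
- by move=> i hi; exists (i + e j); [exact: hZ2D|rewrite addrK].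
Qed.

Lemma esum_hZ2_sum_shift (G : 'I_2 -> 'rV[R]_2 -> R) :
  (forall j i, hZ2 h i -> 0 <= G j i) ->
  (\esum_(i in hZ2 h) (\sum_(j < 2) G j (i - e j))%:E =
   \esum_(i in hZ2 h) (\sum_(j < 2) G j i)%:E)%E.
Proof.
move=> G0.
under eq_esum do rewrite -sumEFin.
under [RHS]eq_esum do rewrite -sumEFin.
rewrite !esum_sum.
- by apply: eq_bigr => j _; rewrite (esum_hZ2_shift j (fun i => (G j i)%:E)).
- by move=> *; rewrite lee_fin G0.
- by move=> *; rewrite lee_fin G0//; exact: hZ2B.
Qed.

(** [X] and [Y] stand for the products of a flux with the values of a function
    at the two ends of an edge: [X j i - Y j (i - e j)] summed over [j] is a
    divergence times the function, [Y - X] is the flux times the increment.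
    Since [esum] is additive on nonnegative families only, the comparison is
    made after adding the dominating family [M = |X| + |Y|] to both; the finite
    totals it brings in are cancelled from the two sides. *)
Lemma summation_by_parts (X Y : 'I_2 -> 'rV[R]_2 -> R) :
  (\esum_(i in hZ2 h) (\sum_(j < 2) `|X j i|)%:E < +oo)%E ->
  (\esum_(i in hZ2 h) (\sum_(j < 2) `|Y j (i - e j)|)%:E < +oo)%E ->
  (forall j i, hZ2 h i -> X j i <= Y j i) ->
  (\esum_(i in hZ2 h) (\sum_(j < 2) (Y j i - X j i))%:E <=
   \esum_(i in hZ2 h) `|\sum_(j < 2) (X j i - Y j (i - e j))|%:E)%E.
Proof.
move=> Xfin; rewrite (esum_hZ2_sum_shift (G := fun j i => `|Y j i|))//.
move=> Yfin XY.
pose M j i := `|X j i| + `|Y j i|.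
have M0 j i : 0 <= M j i by rewrite addr_ge0.
have XM0 j i : 0 <= X j i + M j i.
  by rewrite /M; have := ler_norm (- X j i); rewrite normrN; have := normr_ge0 (Y j i); lra.
have YM0 j i : 0 <= Y j i + M j i.
  by rewrite /M; have := ler_norm (- Y j i); rewrite normrN; have := normr_ge0 (X j i); lra.
pose m := (\esum_(i in hZ2 h) (\sum_(j < 2) M j i)%:E)%E.
pose x := (\esum_(i in hZ2 h) (\sum_(j < 2) (X j i + M j i))%:E)%E.
have m_ge0 : (0 <= m)%E by apply: esum_ge0 => i _; rewrite lee_fin sumr_ge0.
have x_ge0 : (0 <= x)%E by apply: esum_ge0 => i _; rewrite lee_fin sumr_ge0.
have m_fin : m \is a fin_num.
  rewrite ge0_fin_numE// /m; under eq_esum do rewrite big_split.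
  by rewrite esum_EFinD ?lte_add_pinfty//; move=> i _; exact: sumr_ge0.
have x_fin : x \is a fin_num.
  rewrite ge0_fin_numE//; apply: (@le_lt_trans _ _ (m + m)%E).
    rewrite -esum_EFinD; try by move=> i _; exact: sumr_ge0.
    apply: le_esum_EFin => i _; rewrite -big_split /=; apply: ler_sum => j _.
    by rewrite lerD2r /M; have := ler_norm (X j i); have := normr_ge0 (Y j i); lra.
  by rewrite lte_add_pinfty// -ge0_fin_numE.
have mx_fin : (x + m)%E \is a fin_num by rewrite fin_numD x_fin.
rewrite -(leeD2rE _ _ mx_fin) !addeA.
have -> : (\esum_(i in hZ2 h) (\sum_(j < 2) (Y j i - X j i))%:E + x =
    \esum_(i in hZ2 h) (\sum_(j < 2) (Y j i + M j i))%:E)%E.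
  rewrite -esum_EFinD; last by move=> i _; exact: sumr_ge0.
    by apply: eq_esum => i _; rewrite -big_split; congr EFin; apply: eq_bigr => j _ /=; ring.
  by move=> i hi; apply: sumr_ge0 => j _; rewrite subr_ge0 XY.
rewrite -(esum_hZ2_sum_shift (G := fun j i => Y j i + M j i))//.
rewrite [in leRHS]/m -(esum_hZ2_sum_shift (G := M))//.
rewrite -!esum_EFinD//; try by move=> i _; do ?apply: addr_ge0 => //; exact: sumr_ge0.
apply: le_esum_EFin => i _.
have := ler_norm (- \sum_(j < 2) (X j i - Y j (i - e j))).
by rewrite normrN sumrB !big_split /=; lra.
Qed.

End Lattice.
(** * The weighted flux *)

Section Divergence.
Variables (R : realType) (h : R).
Hypothesis h_gt0 : 0 < h.
Local Notation e j := (h *: basis_vec R j).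
Implicit Types (g : 'rV[R]_2 -> R) (i : 'rV[R]_2) (j : 'I_2).

Lemma addr_Dplus g i j : g i + h * Dplus h j g i = g (i + e j).
Proof. by rewrite /Dplus mulrCA divff ?gt_eqF// mulr1 addrC subrK. Qed.

Lemma subr_Dminus g i j : g i + h * - Dminus h j g i = g (i - e j).
Proof.
by rewrite /Dminus mulrN mulrCA divff ?gt_eqF// mulr1 opprB addrC subrK.
Qed.

Lemma Dminus_Dplus g i j : Dminus h j g i = Dplus h j g (i - e j).
Proof. by rewrite /Dminus /Dplus subrK. Qed.

(** The flux of the gradient of [t] across the edge from [i] to [i + e j].  The
    averaging of the weight makes the conductance independent of the
    orientation of the edge, as summation by parts requires. *)
Definition flux (r t : 'rV[R]_2 -> R) j i :=
  (r i ^+ 2 + r (i + e j) ^+ 2) / 2 * Dplus h j t i.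

(** The edge arriving at [i] seen as an edge leaving [i] in the direction
    [- e j], so that estimates for outgoing edges apply to it. *)
Lemma flux_back r t j i : flux r t j (i - e j) =
  - ((r i ^+ 2 + r (i - e j) ^+ 2) / 2 * - Dminus h j t i).
Proof. by rewrite /flux -Dminus_Dplus subrK; ring. Qed.

(** Both sides are [(p i * q k - q i * p k) / h^2] summed over the neighbours
    [k] of [i]: the diagonal terms of the Laplacian cancel. *)
Lemma wronskian_polar (p q r t : 'rV[R]_2 -> R) i :
  (forall k, p k = r k * cos (t k) /\ q k = r k * sin (t k)) ->
  p i * Lap h q i - q i * Lap h p i =
  \sum_(j < 2) (r i * r (i + e j) * sin (t (i + e j) - t i) / h ^+ 2 +
                r i * r (i - e j) * sin (t (i - e j) - t i) / h ^+ 2).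
Proof.
move=> pq; have h0 : h != 0 by rewrite gt_eqF.
have sinE k : r i * r k * sin (t k - t i) = p i * q k - q i * p k.
  by have [-> ->] := pq k; have [-> ->] := pq i; rewrite sinB; ring.
by rewrite sum2E !sinE /Lap /Lap1; field.
Qed.

Lemma divergence_le (p q r t : 'rV[R]_2 -> R) i (B : R) :
  (forall k, p k = r k * cos (t k) /\ q k = r k * sin (t k)) ->
  0 <= r i -> `|p i * Lap h q i - q i * Lap h p i| <= B ->
  `|\sum_(j < 2) (flux r t j i - flux r t j (i - e j)) / h| <=
  h * (\sum_(j < 2) r i ^+ 2 *
         (`|Dplus h j t i| ^+ 3 + `|Dminus h j t i| ^+ 3)
     + \sum_(j < 2) r i * (`|Dplus h j r i| * `|Dplus h j t i| ^+ 2 +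
                           `|Dminus h j r i| * `|Dminus h j t i| ^+ 2)
     + \sum_(j < 2) (`|Dplus h j r i| ^+ 2 * `|Dplus h j t i| +
                     `|Dminus h j r i| ^+ 2 * `|Dminus h j t i|)) + B.
Proof.
move=> pq r0; rewrite (wronskian_polar _ pq) => WB.
set W := \sum_(j < 2) _ in WB.
rewrite -[X in `|X|](subrK W); apply: le_trans (ler_normD _ _) _.
apply: lerD => //; rewrite /W -sumrB; apply: le_trans (ler_norm_sum _ _ _) _.
rewrite -!big_split /= mulr_sumr; apply: ler_sum => j _.
rewrite flux_back opprK mulrDl /flux.
have P := flux_sub_sin_le (Dplus h j r i) (Dplus h j t i) h_gt0 r0.
have N := flux_sub_sin_le (- Dminus h j r i) (- Dminus h j t i) h_gt0 r0.
rewrite !addr_Dplus in P; rewrite !subr_Dminus !normrN in N.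
have hD k : h * Dplus h j t k = t (k + e j) - t k.
  by rewrite -addr_Dplus addrAC subrr add0r.
have hN k : h * - Dminus h j t k = t (k - e j) - t k.
  by rewrite -subr_Dminus addrAC subrr add0r.
rewrite hD in P; rewrite hN in N.
rewrite opprD addrACA; apply: le_trans (ler_normD _ _) _.
by apply: le_trans (lerD P N) _; rewrite -mulrDr ler_wpM2l ?(ltW h_gt0)//; lra.
Qed.

(** Summability of flux times [c]: the neighbouring value of [r] is first traded
    for [r] and its increment, since [c] is only controlled together with [r]
    at the same point.  The factor [M / h^2] is harmless, as only
    finiteness for fixed [h] is at stake. *)
Lemma flux_summand_le (r a b c M : R) : 0 <= r <= M -> `|h * b| <= 2 * pi ->
  `|(r ^+ 2 + (r + h * a) ^+ 2) / 2 * b * c / h| <=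
  3 * pi * M / h ^+ 2 * (r * `|c|) + h * (`|a| ^+ 2 * `|b| * `|c|).
Proof.
move=> /andP[r0 rM] hb; have h0 : h != 0 by rewrite gt_eqF.
have hi : 0 <= h^-1 by rewrite invr_ge0 ltW.
have s0 : 0 <= (r ^+ 2 + (r + h * a) ^+ 2) / 2.
  by rewrite divr_ge0// addr_ge0// sqr_ge0.
rewrite normrM (ger0_norm hi) normrM normrM (ger0_norm s0).
have s1 : (r ^+ 2 + (r + h * a) ^+ 2) / 2 <= 3 / 2 * r ^+ 2 + h ^+ 2 * `|a| ^+ 2.
  rewrite real_normK ?num_real// -subr_ge0.
  rewrite (_ : _ - _ = (r - h * a) ^+ 2 / 2); last by field.
  by rewrite divr_ge0// sqr_ge0.
rewrite normrM (gtr0_norm h_gt0) in hb.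
apply: (@le_trans _ _
  ((3 / 2 * r ^+ 2 + h ^+ 2 * `|a| ^+ 2) * `|b| * `|c| / h)).
  by do 3 apply: ler_wpM2r => //.
rewrite 3!mulrDl.
have -> : h ^+ 2 * `|a| ^+ 2 * `|b| * `|c| / h =
  h * (`|a| ^+ 2 * `|b| * `|c|) by field.
apply: lerD => //.
have -> : 3 / 2 * r ^+ 2 * `|b| * `|c| / h =
  3 / 2 / h ^+ 2 * (r * `|c|) * (r * (h * `|b|)) by field.
have -> : 3 * pi * M / h ^+ 2 * (r * `|c|) =
  3 / 2 / h ^+ 2 * (r * `|c|) * (M * (2 * pi)) by field.
apply: ler_wpM2l; first by rewrite !mulr_ge0// invr_ge0 exprn_ge0// ltW.
by apply: ler_pM => //; rewrite mulr_ge0// ltW.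
Qed.

(** Moving the backward half of the energy along its edge puts the weight
    [r i ^ 2 + r (i + e j) ^ 2] on each forward square, twice the one in [flux],
    so that the energy is twice the sum of flux times increment, to which
    summation by parts applies.  The two finiteness hypotheses give, for fixed
    [h], the absolute summability that it requires; the energy itself is not
    assumed finite. *)
Lemma weighted_energy_le (r t : 'rV[R]_2 -> R) (tinf M : R) :
  let phi i := t i - tinf in
  (forall i, 0 <= r i) -> (forall i, hZ2 h i -> r i <= M) ->
  (forall i k, `|t i - t k| <= 2 * pi) ->
  (\esum_(i in hZ2 h) (r i * `|phi i|)%:E < +oo)%E ->
  (\esum_(i in hZ2 h) (\sum_(j < 2)
    (`|Dplus h j r i| ^+ 2 * `|Dplus h j t i| +
     `|Dminus h j r i| ^+ 2 * `|Dminus h j t i|) * `|phi i|)%:E < +oo)%E ->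
  (\esum_(i in hZ2 h) (\sum_(j < 2)
     r i ^+ 2 * (`|Dplus h j t i| ^+ 2 + `|Dminus h j t i| ^+ 2))%:E <=
   2%:E * \esum_(i in hZ2 h)
     `|(\sum_(j < 2) (flux r t j i - flux r t j (i - e j)) / h) * phi i|%:E)%E.
Proof.
move=> phi r_ge0 rM t_diff; pose k5 i := r i * `|phi i|.
pose k7 i := \sum_(j < 2)
    (`|Dplus h j r i| ^+ 2 * `|Dplus h j t i| +
     `|Dminus h j r i| ^+ 2 * `|Dminus h j t i|) * `|phi i|.
rewrite -/(\esum_(i in hZ2 h) (k5 i)%:E)%E -/(\esum_(i in hZ2 h) (k7 i)%:E)%E.
move=> S5_fin S7_fin.
have k5_ge0 i : 0 <= k5 i by rewrite mulr_ge0.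
have k7_ge0 i : 0 <= k7 i.
  by apply: sumr_ge0 => j _; rewrite !(mulr_ge0, addr_ge0, exprn_ge0).
pose X j i := flux r t j i * phi i / h.
pose Y j i := flux r t j i * phi (i + e j) / h.
(* Covers the edges leaving [i] and those arriving at [i] at once, the latter
   with [a], [b] opposite to the backward differences. *)
have summand_fin (Z a b : 'I_2 -> 'rV[R]_2 -> R) :
    (forall j i, `|h * b j i| <= 2 * pi) ->
    (forall j i, `|Z j i| =
      `|(r i ^+ 2 + (r i + h * a j i) ^+ 2) / 2 * b j i * phi i / h|) ->
    (forall i, \sum_(j < 2) `|a j i| ^+ 2 * `|b j i| * `|phi i| <= k7 i) ->
    (\esum_(i in hZ2 h) (\sum_(j < 2) `|Z j i|)%:E < +oo)%E.
  move=> hb ZE ab_le; pose c := 2 * (3 * pi * `|M| / h ^+ 2).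
  have c_ge0 : 0 <= c.
    by rewrite !mulr_ge0 ?pi_ge0// invr_ge0 exprn_ge0// ltW.
  apply: (@le_lt_trans _ _ (c%:E * (\esum_(i in hZ2 h) (k5 i)%:E) +
      h%:E * \esum_(i in hZ2 h) (k7 i)%:E)%E); last first.
    by apply: lte_add_pinfty; apply: lte_mul_pinfty => //; rewrite lee_fin ltW.
  apply: le_trans (leeD (esum_EFinZ_le _ c_ge0 k5_ge0)
    (esum_EFinZ_le _ (ltW h_gt0) k7_ge0)).
  rewrite -esum_EFinD; try by move=> i _; rewrite mulr_ge0// ltW.
  apply: le_esum_EFin => i hi.
  apply: (@le_trans _ _ (\sum_(j < 2) (3 * pi * `|M| / h ^+ 2 * k5 i +
      h * (`|a j i| ^+ 2 * `|b j i| * `|phi i|)))).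
    apply: ler_sum => j _; rewrite ZE; apply: flux_summand_le => //.
    by rewrite r_ge0 (le_trans (rM _ hi))// ler_norm.
  rewrite big_split /=; apply: lerD; last first.
    by rewrite -mulr_sumr ler_wpM2l ?(ltW h_gt0).
  by rewrite sum2E /c; lra.
have Xfin : (\esum_(i in hZ2 h) (\sum_(j < 2) `|X j i|)%:E < +oo)%E.
  apply: (summand_fin _ (fun j => Dplus h j r) (fun j => Dplus h j t)).
  - move=> j i; have := addr_Dplus t i j.
    by move/(canRL (addKr _)) => ->; rewrite addrC.
  - by move=> j i; rewrite addr_Dplus.
  - move=> i; apply: ler_sum => j _; rewrite ler_wpM2r// lerDl.
    by rewrite mulr_ge0 ?exprn_ge0.
have Yfin : (\esum_(i in hZ2 h) (\sum_(j < 2) `|Y j (i - e j)|)%:E < +oo)%E.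
  apply: (summand_fin _ (fun j i => - Dminus h j r i)
    (fun j i => - Dminus h j t i)).
  - move=> j i; have := subr_Dminus t i j.
    by move/(canRL (addKr _)) => ->; rewrite addrC.
  - move=> j i; rewrite subr_Dminus /Y flux_back subrK.
    by rewrite !mulNr normrN.
  - move=> i; apply: ler_sum => j _; rewrite !normrN ler_wpM2r// lerDr.
    by rewrite mulr_ge0 ?exprn_ge0.
have YXE j i : Y j i - X j i =
    (r i ^+ 2 + r (i + e j) ^+ 2) / 2 * `|Dplus h j t i| ^+ 2.
  have hD : Dplus h j t i = (t (i + e j) - t i) / h by [].
  by rewrite real_normK ?num_real// /Y /X /flux /phi -/(e j) !hD; ring.
have XY j i : hZ2 h i -> X j i <= Y j i.
  move=> _; rewrite -subr_ge0 YXE.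
  by rewrite !(mulr_ge0, addr_ge0, exprn_ge0, invr_ge0).
have LE : (\esum_(i in hZ2 h) (\sum_(j < 2)
     r i ^+ 2 * (`|Dplus h j t i| ^+ 2 + `|Dminus h j t i| ^+ 2))%:E <=
     2%:E * \esum_(i in hZ2 h) (\sum_(j < 2) (Y j i - X j i))%:E)%E.
  pose V j i := r (i + e j) ^+ 2 * `|Dplus h j t i| ^+ 2.
  have V_ge0 j i : 0 <= V j i by rewrite mulr_ge0 ?exprn_ge0.
  have W_ge0 j i : 0 <= r i ^+ 2 * `|Dplus h j t i| ^+ 2.
    by rewrite mulr_ge0 ?exprn_ge0.
  under eq_esum => i _.
    rewrite (eq_bigr (fun j =>
      r i ^+ 2 * `|Dplus h j t i| ^+ 2 + V j (i - e j))).
      by rewrite big_split /=; over.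
    by move=> j _; rewrite mulrDr /V subrK Dminus_Dplus.
  rewrite esum_EFinD//; try by move=> i _; exact: sumr_ge0.
  rewrite esum_hZ2_sum_shift//.
  rewrite -esum_EFinD//; try by move=> i _; exact: sumr_ge0.
  have YX_ge0 i : 0 <= \sum_(j < 2) (Y j i - X j i).
    apply: sumr_ge0 => j _.
    by rewrite YXE !(mulr_ge0, addr_ge0, exprn_ge0, invr_ge0).
  apply: le_trans (esum_EFinZ_le _ (ler0n _ 2) YX_ge0).
  apply: le_esum_EFin => i hi; rewrite -big_split mulr_sumr.
  by apply: ler_sum => j _; rewrite YXE /V /=; lra.
apply: (le_trans LE); apply: lee_wpmul2l; first by rewrite lee_fin.
apply: le_trans (summation_by_parts Xfin Yfin XY) _.
apply: le_esum_EFin => i _; rewrite le_eqVlt; apply/orP; left; apply/eqP.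
rewrite mulr_suml; congr `|_|; apply: eq_bigr => j _.
by rewrite /X /Y subrK; ring.
Qed.

End Divergence.

(** * The energy estimate *)

Theorem theorem1p1 (R : realType) (h : R) (h_gt0 : 0 < h) (h_le1 : h <= 1)
  (f : 'rV[R]_2 -> R -> R) (u : 'rV[R]_2 -> R)
  (u_sol : forall i, hZ2 h i -> Lap h u i = f i (u i))
  (Lf : 'rV[R]_2 -> R -> R) (kappa0 : R) (kappa0_gt0 : 0 < kappa0)
  (f_lin : forall i, hZ2 h i ->
    \sum_(j < 2)
      `|f (i + h *: basis_vec R j) (u (i + h *: basis_vec R j)) - f i (u i)
        - Lf i (u i) * (u (i + h *: basis_vec R j) - u i)| / h
    <= kappa0 * h)
  (u_neq : forall i, hZ2 h i ->
    0 < \sum_(j < 2) `|u (i + h *: basis_vec R j) - u i| ^+ 2)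
  (kappa1_fin : (kappa1 h u < +oo)%E)
  (kappa2_fin : (kappa2 h u < +oo)%E)
  (tinf : R) (tinf_bounds : - pi < tinf <= pi)
  (kappa3_fin : (kappa3 h u tinf < +oo)%E)
  (kappa4_fin : (kappa4 h u tinf < +oo)%E)
  (kappa5_fin : (kappa5 h u kappa0 tinf < +oo)%E)
  (kappa6_fin : (kappa6 h u tinf < +oo)%E)
  (kappa7_fin : (kappa7 h u tinf < +oo)%E) :
  let r := rhoplus h u in
  let t := thetaplus h u in
  let C : \bar R :=
    (4%:E * (kappa2 h u
             + (2 * expR (2 * pi))%:E * kappa3 h u tinf
             + (2 * expR (2 * pi))%:E * kappa4 h u tinf
             + 2%:E * kappa5 h u kappa0 tinf
             + kappa6 h u tinf
             + kappa7 h u tinf))%E in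
  (\esum_(i in hZ2 h) (\sum_(j < 2)
     r i ^+ 2 * (`|Dplus h j t i| ^+ 2 + `|Dminus h j t i| ^+ 2))%:E
   <= C * h%:E)%E.
Proof.
cbv zeta; set r := rhoplus h u; set t := thetaplus h u.
set e := fun j : 'I_2 => h *: basis_vec R j.
pose phi i := t i - tinf.
have r_ge0 i : 0 <= r i by exact: rhoplus_ge0.
have t_diff a b : `|t a - t b| <= 2 * pi.
  rewrite mulr2n mulrDl mul1r; apply: le_trans (ler_normB _ _) _.
  by apply: lerD; exact: normr_thetaplus_le.
have [M rM] : exists M, forall i, hZ2 h i -> r i <= M.
  have k1_ge0 : (0 <= kappa1 h u)%E.
    apply: (@le_trans _ _ (`|Dplus h 0 u 0|)%:E); first by rewrite lee_fin.
    apply: ereal_sup_ubound; exists 0; last by exists 0.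
    by exists 0; rewrite map_mx0 scaler0.
  have k1_fin : kappa1 h u \is a fin_num by rewrite ge0_fin_numE.
  have D_le j i : hZ2 h i -> `|Dplus h j u i| <= fine (kappa1 h u).
    move=> hi; rewrite -lee_fin fineK//; apply: ereal_sup_ubound.
    by exists i => //; exists j.
  exists (fine (kappa1 h u) + fine (kappa1 h u)) => i hi.
  by apply: le_trans (rhoplus_le _ _ _) _; rewrite lerD ?D_le.
pose k3 i := \sum_(j < 2)
    r i ^+ 2 * (`|Dplus h j t i| ^+ 3 + `|Dminus h j t i| ^+ 3) * `|phi i|.
pose k4 i := \sum_(j < 2)
    r i * (`|Dplus h j r i| * `|Dplus h j t i| ^+ 2 +
           `|Dminus h j r i| * `|Dminus h j t i| ^+ 2) * `|phi i|.
pose k5 i := r i * `|phi i|.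
pose k7 i := \sum_(j < 2)
    (`|Dplus h j r i| ^+ 2 * `|Dplus h j t i| +
     `|Dminus h j r i| ^+ 2 * `|Dminus h j t i|) * `|phi i|.
have k3_ge0 i : 0 <= k3 i.
  by apply: sumr_ge0 => j _; rewrite !(mulr_ge0, addr_ge0, exprn_ge0).
have k4_ge0 i : 0 <= k4 i.
  by apply: sumr_ge0 => j _; rewrite !(mulr_ge0, addr_ge0, exprn_ge0).
have k5_ge0 i : 0 <= k5 i by rewrite mulr_ge0.
have k7_ge0 i : 0 <= k7 i.
  by apply: sumr_ge0 => j _; rewrite !(mulr_ge0, addr_ge0, exprn_ge0).
have S_ge0 (g : 'rV[R]_2 -> R) : (forall i, 0 <= g i) ->
    (0 <= \esum_(i in hZ2 h) (g i)%:E)%E.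
  by move=> g0; apply: esum_ge0 => i _; rewrite lee_fin.
(* An infinite sum times the positive [kappa0] would make [kappa5] infinite. *)
have S5_fin : (\esum_(i in hZ2 h) (k5 i)%:E < +oo)%E.
  rewrite ltey; apply: contraPneq kappa5_fin => S5.
  rewrite /kappa5 -/r -/t -[X in (_ * X)%E]/(\esum_(i in hZ2 h) (k5 i)%:E)%E S5.
  by rewrite gt0_muley ?lte_fin.
have T_le i : hZ2 h i ->
    `|(\sum_(j < 2) (flux h r t j i - flux h r t j (i - e j)) / h) * phi i| <=
    h * (k3 i + k4 i + k7 i + kappa0 * k5 i).
  move=> hi.
  have W := wronskian_le h_gt0 u_sol f_lin hi.
  have := divergence_le h_gt0 (Uplus_polar h u) (r_ge0 i) W.
  rewrite -/r -/t -/e => G_le.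
  rewrite normrM; apply: le_trans (ler_wpM2r _ G_le) _ => //.
  by rewrite /k3 /k4 /k7 -!mulr_suml /k5 -/(r i); lra.
have T_sum : (\esum_(i in hZ2 h)
    `|(\sum_(j < 2) (flux h r t j i - flux h r t j (i - e j)) / h) * phi i|%:E <=
   h%:E * (kappa3 h u tinf + kappa4 h u tinf + kappa7 h u tinf
     + kappa5 h u kappa0 tinf))%E.
  apply: le_trans (le_esum_EFin T_le) _.
  have K_ge0 i : 0 <= k3 i + k4 i + k7 i + kappa0 * k5 i.
    by rewrite !addr_ge0// mulr_ge0// ltW.
  apply: le_trans (esum_EFinZ_le _ (ltW h_gt0) K_ge0) _.
  apply: lee_wpmul2l; first by rewrite lee_fin ltW.
  rewrite !esum_EFinD; try by move=> i _; rewrite ?addr_ge0// mulr_ge0// ltW.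
  by apply: leeD => //; apply: esum_EFinZ_le => //; exact: ltW.
apply: le_trans (weighted_energy_le h_gt0 r_ge0 rM t_diff S5_fin kappa7_fin) _.
apply: le_trans (lee_wpmul2l _ T_sum) _; first by rewrite lee_fin.
have fin3 : kappa3 h u tinf \is a fin_num by rewrite ge0_fin_numE//; exact: S_ge0.
have fin4 : kappa4 h u tinf \is a fin_num by rewrite ge0_fin_numE//; exact: S_ge0.
have fin7 : kappa7 h u tinf \is a fin_num by rewrite ge0_fin_numE//; exact: S_ge0.
have K5 : (kappa5 h u kappa0 tinf =
    kappa0%:E * \esum_(i in hZ2 h) (k5 i)%:E)%E by [].
have fin5 : kappa5 h u kappa0 tinf \is a fin_num.
  by rewrite ge0_fin_numE// K5 mule_ge0 ?S_ge0// lee_fin ltW.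
have fin2 : kappa2 h u \is a fin_num.
  rewrite ge0_fin_numE//; apply: S_ge0 => i; apply: sumr_ge0 => j _.
  by rewrite !(mulr_ge0, addr_ge0, exprn_ge0).
have fin6 : kappa6 h u tinf \is a fin_num.
  rewrite ge0_fin_numE//; apply: S_ge0 => i; apply: sumr_ge0 => j _.
  by rewrite !(mulr_ge0, addr_ge0, exprn_ge0)// ltW.
have kap_ge0 (g : 'rV[R]_2 -> R) : (forall i, 0 <= g i) ->
    0 <= fine (\esum_(i in hZ2 h) (g i)%:E)%E.
  by move=> g0; rewrite fine_ge0// S_ge0.
have f2 : 0 <= fine (kappa2 h u).
  by apply: kap_ge0 => i; apply: sumr_ge0 => j _;
    rewrite !(mulr_ge0, addr_ge0, exprn_ge0).
have f3 : 0 <= fine (kappa3 h u tinf) by exact: kap_ge0.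
have f4 : 0 <= fine (kappa4 h u tinf) by exact: kap_ge0.
have f6 : 0 <= fine (kappa6 h u tinf).
  by apply: kap_ge0 => i; apply: sumr_ge0 => j _;
    rewrite !(mulr_ge0, addr_ge0, exprn_ge0)// ltW.
have f7 : 0 <= fine (kappa7 h u tinf) by exact: kap_ge0.
have f5 : 0 <= fine (kappa5 h u kappa0 tinf).
  by rewrite fine_ge0// K5 mule_ge0 ?S_ge0// lee_fin ltW.
move: f2 f3 f4 f5 f6 f7.
rewrite -(fineK fin2) -(fineK fin3) -(fineK fin4) -(fineK fin5) -(fineK fin6).
rewrite -(fineK fin7) /=.
move: (fine _) (fine _) (fine _) (fine _) (fine _) (fine _) => a7 a6 a5 a4 a3 a2.
move=> f2 f3 f4 f5 f6 f7; rewrite -!(EFinM, EFinD) lee_fin.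
(* The factor 2 in front of [kappa3] and [kappa4] is to be compared with
   [8 * expR (2 * pi)]. *)
have e1 : 1 <= expR (2 * pi : R) by rewrite -expR0 ler_expR mulr_ge0 ?pi_ge0.
rewrite mulrCA [leRHS]mulrC ler_wpM2l ?(ltW h_gt0)//.
have := ler_wpM2r f3 e1; have := ler_wpM2r f4 e1.
rewrite !mul1r; lra.
Qed.
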